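(* Let $\mathbf{X}=(X_\lambda,p_{\lambda\lambda'},\Lambda)$ and $\mathbf{Y}=(Y_\mu,q_{\mu\mu'},M)$ be inverse systems in a category $\mathcal{C}$ and let $(f_\mu,\phi),(f'_\mu,\phi'):\mathbf{X}\rightarrow\mathbf{Y}$ be two equivalent morphisms of inverse systems, $(f_\mu,\phi)\sim(f'_\mu,\phi')$. If the morphism $(f_\mu,\phi)$ is movable, then the morphism $(f'_\mu,\phi')$ is also movable.
   Context: An inverse system $\mathbf{X}=(X_\lambda,p_{\lambda\lambda'},\Lambda)$ in a category $\mathcal{C}$ consists of a directed preordered set $\Lambda$, objects $X_\lambda$, and morphisms $p_{\lambda\lambda'}:X_{\lambda'}\to X_\lambda$ for $\lambda\le\lambda'$ with $p_{\lambda\lambda}=1$ and $p_{\lambda\lambda'}\circ p_{\lambda'\lambda''}=p_{\lambda\lambda''}$. All index sets are assumed to be cofinite directed sets (each element has only finitely many predecessors). A morphism of inverse systems $(f_\mu,\phi):\mathbf{X}\to\mathbf{Y}$ consists of a function $\phi:M\to\Lambda$ and morphisms $f_\mu:X_{\phi(\mu)}\to Y_\mu$ such that whenever $\mu\le\mu'$ there is $\lambda\ge\phi(\mu),\phi(\mu')$ with $f_\mu\circ p_{\phi(\mu)\lambda}=q_{\mu\mu'}\circ f_{\mu'}\circ p_{\phi(\mu')\lambda}$. For $\lambda\ge\phi(\mu)$ write $f_{\mu\lambda}:=f_\mu\circ p_{\phi(\mu)\lambda}$. Equivalence: $(f_\mu,\phi)\sim(f'_\mu,\phi')$ if for every $\mu\in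 M$ there is $\lambda\ge\phi(\mu),\phi'(\mu)$ with $f_\mu\circ p_{\phi(\mu)\lambda}=f'_\mu\circ p_{\phi'(\mu)\lambda}$. Movable morphism: $(f_\mu,\phi)$ is movable if every $\mu\in M$ admits $\lambda\in\Lambda$, $\lambda\ge\phi(\mu)$, such that each $\mu'\ge\mu$ in $M$ admits a morphism $u:X_\lambda\to Y_{\mu'}$ in $\mathcal{C}$ with $f_{\mu\lambda}=q_{\mu\mu'}\circ u$. *)

(* Defs.v *)
From Stdlib Require Import RelationClasses List.

Set Implicit Arguments.
Unset Strict Implicit.
Unset Printing Implicit Defensive.

Record category := Category {
  obj :> Type;
  hom : obj -> obj -> Type;
  idm : forall A : obj, hom A A;
  comp : forall A B D : obj, hom B D -> hom A B -> hom A D;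
  comp_idl : forall (A B : obj) (f : hom A B), comp (idm B) f = f;
  comp_idr : forall (A B : obj) (f : hom A B), comp f (idm A) = f;
  comp_assoc : forall (A B D E : obj) (h : hom D E) (g : hom B D) (f : hom A B),
    comp h (comp g f) = comp (comp h g) f
}.

Arguments hom {c} A B.
Arguments idm {c} A.

Notation "g '∘' f" := (comp g f) (at level 40, left associativity).

(* Antisymmetry is not required. Finiteness of the set of predecessors is
   expressed by a list that contains all of them. *)
Record cofinite_directed_set := CofiniteDirectedSet {
  index :> Type;
  le : index -> index -> Prop;
  le_preorder : PreOrder le;
  index_nonempty : inhabited index;
  le_directed : forall a b : index, exists c : index, le a c /\ le b c;
  le_cofinite : forall a : index,
    exists s : list index, forall b : index, le b a -> In b s
}.

Notation "a ≼ b" := (le a b) (at level 70, no associativity).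

(* [bond] takes a proof of [a ≼ b]. Since the two laws hold for all such
   proofs, they imply that [bond] does not depend on the proof. *)
Record inverse_system (C : category) (L : cofinite_directed_set) :=
  InverseSystem {
  term :> L -> C;
  bond : forall a b : L, a ≼ b -> hom (term b) (term a);
  bond_id : forall (a : L) (h : a ≼ a), bond h = idm (term a);
  bond_comp : forall (a b c : L) (hab : a ≼ b) (hbc : b ≼ c) (hac : a ≼ c),
    bond hab ∘ bond hbc = bond hac
}.

Arguments bond {C L} i {a b} h.

Record inverse_system_morphism (C : category) (L M : cofinite_directed_set)
    (X : inverse_system C L) (Y : inverse_system C M) := InverseSystemMorphism {
  index_map : M -> L;
  mor : forall m : M, hom (X (index_map m)) (Y m);
  mor_compat : forall (m m' : M) (hm : m ≼ m'),
    exists (l : L) (h : index_map m ≼ l) (h' : index_map m' ≼ l),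
      mor m ∘ bond X h = bond Y hm ∘ mor m' ∘ bond X h'
}.

Section Morphisms.
Context {C : category} {L M : cofinite_directed_set}.
Context {X : inverse_system C L} {Y : inverse_system C M}.

Definition mor_at (f : inverse_system_morphism X Y) (m : M) (l : L)
    (h : index_map f m ≼ l) : hom (X l) (Y m) :=
  mor f m ∘ bond X h.

Definition equivalent (f g : inverse_system_morphism X Y) : Prop :=
  forall m : M, exists (l : L) (hf : index_map f m ≼ l) (hg : index_map g m ≼ l),
    mor_at hf = mor_at hg.

Definition movable (f : inverse_system_morphism X Y) : Prop :=
  forall m : M, exists (l : L) (h : index_map f m ≼ l),
    forall (m' : M) (hm : m ≼ m'),
      exists u : hom (X l) (Y m'), mor_at h = bond Y hm ∘ u.

End Morphisms.

(* Main.v *)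
Require Import Defs.
From Stdlib Require Import RelationClasses.

(** Both movability and equivalence at an index [m] are witnessed by one index
    of [X], and both kinds of witness survive passing to a larger index. At a
    common upper bound [n] of the two witnesses, [f] and [f'] restrict to the
    same morphism from [X n] to [Y m], so the factorizations of the first
    through the bonds of [Y], precomposed with a bond of [X], are
    factorizations of the second. *)

Lemma mor_at_bond (C : category) (L M : cofinite_directed_set)
    (X : inverse_system C L) (Y : inverse_system C M)
    (f : inverse_system_morphism X Y) (m : M) (l n : L)
    (hl : index_map f m ≼ l) (hn : index_map f m ≼ n) (hln : l ≼ n) :
  mor_at hl ∘ bond X hln = mor_at hn.
Proof.
  unfold mor_at.
  rewrite <- comp_assoc.
  now rewrite (bond_comp X hl hln hn).
Qed.

Theorem proposition2p10 (C : category) (L M : cofinite_directed_set)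
    (X : inverse_system C L) (Y : inverse_system C M)
    (f f' : inverse_system_morphism X Y) :
  equivalent f f' -> movable f -> movable f'.
Proof.
  intros Heq Hmov m.
  destruct (Hmov m) as [l [hl Hfactor]].
  destruct (Heq m) as [k [hk [hk' Hk]]].
  destruct (le_directed l k) as [n [hln hkn]].
  pose proof (@PreOrder_Transitive _ _ (le_preorder L)) as trans.
  pose proof (trans _ _ _ hl hln) as hn.
  pose proof (trans _ _ _ hk' hkn) as hn'.
  assert (Hn : mor_at hn' = mor_at hn).
  { rewrite <- (mor_at_bond _ _ _ _ _ f' _ _ _ hk' hn' hkn), <- Hk.
    apply mor_at_bond. }
  exists n, hn'.
  intros m' hm.
  destruct (Hfactor m' hm) as [u Hu].
  exists (u ∘ bond X hln).
  rewrite Hn, <- (mor_at_bond _ _ _ _ _ f _ _ _ hl hn hln), Hu.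
  symmetry. apply comp_assoc.
Qed.
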